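(* Let $\mathcal{P}$ be a convex family of probability distributions over $\mathcal{Z}$ such that every affine function $\mathcal{P}\to\mathbb{R}$ is presentable. Let $D:\mathcal{P}\times\mathcal{P}\to[0,\infty)$ be a discrepancy function, i.e. $D(P,Q)\ge 0$ and $D(P,P)=0$ for all $P,Q\in\mathcal{P}$. Then $D$ is coherent if and only if, for all $Q,Q_0\in\mathcal{P}$, the function $$P\mapsto D(P,Q)-D(P,Q_0)$$ is affine on $\mathcal{P}$. Moreover, in that case, for any fixed $Q_0\in\mathcal{P}$ there is a proper scoring rule over $\mathcal{P}$ whose discrepancy function is $D$ and whose uncertainty function is $H(P)=-D(P,Q_0)$.
   Context: $\mathcal{P}$ is convex in the sense that $E(\tilde P)\in\mathcal{P}$ for every random element $\tilde P$ of $\mathcal{P}$. A function $F:\mathcal{P}\to\mathbb{R}$ is affine if $E\{F(\tilde P)\}=F\{E(\tilde P)\}$ for every random element $\tilde P$ of $\mathcal{P}$; it is presentable if there is a function $f:\mathcal{Z}\to\mathbb{R}$ with $F(P)=E_P\{f(Z)\}$ for all $P\in\mathcal{P}$. A scoring rule $S(z,Q)$ ($z\in\mathcal{Z}$, $Q\in\mathcal{P}$), with $S(P,Q):=E_P\{S(Z,Q)\}$, is proper over $\mathcal{P}$ if $S(P,P)$ is finite and $S(P,P)\le S(P,Q)$ for all $P,Q\in\mathcal{P}$. Its uncertainty function is $H(P):=S(P,P)$ and its discrepancy function is $S(P,Q)-S(P,P)$. A discrepancy function $D$ on $\mathcal{P}$ is coherent if it arises from a decision problem, that is, if $D(P,Q)=L\{P,a(Q)\}-L\{P,a(P)\}$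 for some action space $\mathcal{A}$ and loss function $L(z,a)$ with domain $\mathcal{P}$; equivalently, if $D$ is the discrepancy function of some proper scoring rule over $\mathcal{P}$. Here $L(P,a):=E_P\{L(Z,a)\}$, and $L$ has domain $\mathcal{P}$ if $L(P,a)$ exists (possibly infinite) for all $P\in\mathcal{P}$, $a\in\mathcal{A}$, and for each $P\in\mathcal{P}$ the infimum $\inf_{a}L(P,a)$ is finite and attained at a (chosen) Bayes act $a(P)$. *)

(* Defs.v *)
From HB Require Import structures.
From mathcomp Require Import all_boot all_order all_algebra.
From mathcomp Require Import all_classical all_reals all_analysis.
From mathcomp Require Import measurable_realfun giry.

Set Implicit Arguments.
Unset Strict Implicit.
Unset Printing Implicit Defensive.

Import Order.TTheory GRing.Theory Num.Theory.
Import numFieldNormedType.Exports.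

Local Open Scope classical_set_scope.
Local Open Scope ring_scope.
Local Open Scope ereal_scope.

(* A family of distributions over Z is given as P : I -> probability Z R with
   the injectivity condition [distinct_distributions], so that I stands for the
   set of distributions itself. A library measure is a function on all subsets
   of Z, so that one distribution (values on the measurable sets) is represented
   by many terms of type [probability Z R]; with the indexing, functions on I
   are exactly the functions on the set of distributions. *)

Section family.
Context (R : realType) (d : measure_display) (Z : measurableType d).
Context (I : Type) (P : I -> probability Z R).

Definition distinct_distributions : Prop :=
  forall i j : I, P i ≡μ P j -> i = j.

Section random.
Context (d' : measure_display) (Om : measurableType d') (mu : probability Om R).

(* [pprobability Z R] carries the sigma-algebra generated by the evaluations
   at the measurable sets of Z. *)
Definition random_element (X : Om -> I) : Prop :=
  measurable_fun setT (fun w => P (X w) : pprobability Z R).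

(* q is the mean E(X) of X: the mixture of the distributions P (X w). *)
Definition is_mean (X : Om -> I) (q : I) : Prop :=
  forall A : set Z, measurable A -> P q A = \int[mu]_w P (X w) A.

End random.

Definition convex_family : Prop :=
  forall (d' : measure_display) (Om : measurableType d')
    (mu : probability Om R) (X : Om -> I),
    random_element X -> exists q : I, is_mean mu X q.

Definition affine (F : I -> R) : Prop :=
  forall (d' : measure_display) (Om : measurableType d')
    (mu : probability Om R) (X : Om -> I) (q : I),
    random_element X -> is_mean mu X q ->
    mu.-integrable setT (EFin \o (F \o X)) /\ 'E_mu[F \o X] = (F q)%:E.

Definition presentable (F : I -> R) : Prop :=
  exists f : Z -> R, forall i : I,
    (P i).-integrable setT (EFin \o f) /\ 'E_(P i)[f] = (F i)%:E.

(* The library integral is total (it returns -oo for +oo - +oo), so the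
   existence of an expectation, possibly infinite, has to be required. *)
Definition has_expectation (i : I) (g : Z -> \bar R) : Prop :=
  measurable_fun setT g /\
  (\int[P i]_z g^\+ z < +oo \/ \int[P i]_z g^\- z < +oo).

Definition expected_loss (A : Type) (L : Z -> A -> \bar R) (i : I) (a : A)
  : \bar R := \int[P i]_z L z a.

(* L has the family as domain, and bayes is a choice of Bayes acts for L. *)
Definition loss_with_bayes_acts (A : Type) (L : Z -> A -> \bar R)
    (bayes : I -> A) : Prop :=
  (forall (i : I) (a : A), has_expectation i (L ^~ a)) /\
  (forall i : I,
     ereal_inf (range (expected_loss L i)) \is a fin_num /\
     expected_loss L i (bayes i) = ereal_inf (range (expected_loss L i))).

Definition coherent (D : I -> I -> R) : Prop :=
  exists (A : Type) (L : Z -> A -> \bar R) (bayes : I -> A),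
    loss_with_bayes_acts L bayes /\
    forall i j : I,
      (D i j)%:E =
        expected_loss L i (bayes j) - expected_loss L i (bayes i).

Definition expected_score (S : Z -> I -> \bar R) (i j : I) : \bar R :=
  \int[P i]_z S z j.

Definition proper_scoring_rule (S : Z -> I -> \bar R) : Prop :=
  (forall i j : I, has_expectation i (S ^~ j)) /\
  (forall i : I, expected_score S i i \is a fin_num) /\
  (forall i j : I, expected_score S i i <= expected_score S i j).

Definition uncertainty (S : Z -> I -> \bar R) (i : I) : \bar R :=
  expected_score S i i.

Definition discrepancy (S : Z -> I -> \bar R) (i j : I) : \bar R :=
  expected_score S i j - expected_score S i i.

End family.

(* Main.v *)
Require Import Defs.
From HB Require Import structures.
From mathcomp Require Import all_boot all_order all_algebra.
From mathcomp Require Import all_classical all_reals all_analysis.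
From mathcomp Require Import measurable_realfun giry.

(** A coherent discrepancy is a difference of expected losses, and the expected
    loss of a fixed act is linear in the distribution; a discrepancy with
    affine differences is, conversely, turned into a score by presentability.

    Necessity: in [D i j = L (P i, a j) - L (P i, a i)] the second term is
    finite, being the infimum at [P i], hence so is the first. In the difference
    [D i j - D i j0] the Bayes risk at [P i] cancels, leaving the expectation
    under [P i] of the integrable function [L (., a j) - L (., a j0)]. Such an
    expectation is affine ([affine_expectation]): by Tonelli's theorem for
    mixtures ([integral_mean]) the integral against the mean of a random
    distribution is the mean of the integrals, first for nonnegative functions,
    then for the positive and negative parts of an integrable one.

    Sufficiency and the last claim: fix [j0] and present each affine function
    [D(., j) - D(., j0)] by some [f_j : Z -> R]. The score [S(z, j) = f_j z] has
    expected score [D i j - D i j0] under [P i]. Subtracting its diagonal value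
    [- D i j0] leaves [D i j], which is nonnegative, so that [S] is proper
    ([proper_score_of_affine]). A proper scoring rule is itself a decision
    problem whose acts are the distributions, with the quoted distribution
    as Bayes act ([proper_scoring_rule_coherent]). *)

Set Implicit Arguments.
Unset Strict Implicit.
Unset Printing Implicit Defensive.

Import Order.TTheory GRing.Theory Num.Theory.
Import numFieldNormedType.Exports.

Local Open Scope classical_set_scope.
Local Open Scope ring_scope.
Local Open Scope ereal_scope.

Lemma fin_num_integrable (R : realType) (d : measure_display)
    (T : measurableType d) (mu : {measure set T -> \bar R}) (g : T -> \bar R) :
  measurable_fun setT g -> \int[mu]_x g x \is a fin_num ->
  mu.-integrable setT g.
Proof.
move=> mg; rewrite integralE => gfin; apply/integrableP; split => //.
under eq_integral do rewrite -/((abse \o g) _) fune_abse.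
rewrite ge0_integralD//; last 2 first.
- exact: measurable_funepos.
- exact: measurable_funeneg.
have : 0 <= \int[mu]_x g^\+ x by exact: integral_ge0.
have : 0 <= \int[mu]_x g^\- x by exact: integral_ge0.
move: gfin.
by case: (\int[mu]_x g^\+ x) => [p||]; case: (\int[mu]_x g^\- x) => [n||];
  rewrite //= ltry.
Qed.

Section mixtures.
Context (R : realType) (d : measure_display) (Z : measurableType d).
Context (I : Type) (P : I -> probability Z R).
Context (d' : measure_display) (Om : measurableType d') (mu : probability Om R).
Context (X : Om -> I) (mX : random_element P X).

(** The sigma-algebra on distributions under which [X] is a random element
    makes [w |-> P (X w)] a probability kernel; the same map is then measurable
    into the Giry space, where the monadic bind gives Tonelli's theorem. *)
Lemma measurable_random_giry :
  measurable_fun setT (fun w => P (X w) : giry Z R).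
Proof.
apply: measurable_giry_codensity => // B mB.
exact: (measurable_kernel (kprobability mX) B mB).
Qed.

Lemma measurable_random_integral (h : Z -> \bar R) :
  measurable_fun setT h -> (forall z, 0 <= h z) ->
  measurable_fun setT (fun w => \int[P (X w)]_z h z).
Proof.
move=> mh h0.
exact: (measurableT_comp (measurable_giry_int mh h0) measurable_random_giry).
Qed.

(** The mean [P q] and the Giry bind of [mu] with [w |-> P (X w)] agree on
    measurable sets, hence integrate functions alike. *)
Lemma integral_mean (q : I) (h : Z -> \bar R) :
  is_mean P mu X q -> measurable_fun setT h -> (forall z, 0 <= h z) ->
  \int[P q]_z h z = \int[mu]_w \int[P (X w)]_z h z.
Proof.
move=> Xq mh h0.
rewrite -[RHS](giry_int_bind mu measurable_random_giry mh h0).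
apply: eq_measure_integral => A mA _.
apply: (etrans (Xq A mA)); rewrite [RHS]giry_int_map//.
exact: measurable_giry_ev.
Qed.

Lemma integrable_random_integral (q : I) (h : Z -> \bar R) :
  is_mean P mu X q -> measurable_fun setT h -> (forall z, 0 <= h z) ->
  \int[P q]_z h z < +oo ->
  mu.-integrable setT (fun w => \int[P (X w)]_z h z).
Proof.
move=> Xq mh h0 hoo; apply/integrableP; split.
  exact: measurable_random_integral.
under eq_integral do rewrite gee0_abs ?integral_ge0//.
by rewrite -(integral_mean Xq).
Qed.

End mixtures.

Section family.
Context (R : realType) (d : measure_display) (Z : measurableType d).
Context (I : Type) (P : I -> probability Z R).

(** Tonelli applies to [g^\+] and [g^\-] separately; integrability of [g] under
    the mean [P q] makes both iterated integrals finite, so that they subtract.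
    A loss may be infinite somewhere, hence [g] is extended real-valued. *)
Lemma affine_expectation (F : I -> R) (g : Z -> \bar R) :
  (forall i, (P i).-integrable setT g) ->
  (forall i, \int[P i]_z g z = (F i)%:E) -> affine P F.
Proof.
move=> ig gF d' Om mu X q mX Xq.
have mg := measurable_int _ (ig q).
have mgp : measurable_fun setT g^\+ by exact: measurable_funepos.
have mgn : measurable_fun setT g^\- by exact: measurable_funeneg.
have ipos : mu.-integrable setT (fun w => \int[P (X w)]_z g^\+ z).
  apply: (integrable_random_integral mX Xq) => //.
  exact: integral_funepos_lt_pinfty (ig q).
have ineg : mu.-integrable setT (fun w => \int[P (X w)]_z g^\- z).
  apply: (integrable_random_integral mX Xq) => //.
  exact: integral_funeneg_lt_pinfty (ig q).
have FX : EFin \o (F \o X) =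
    (fun w => \int[P (X w)]_z g^\+ z) \- (fun w => \int[P (X w)]_z g^\- z).
  by apply/funext => w /=; rewrite -gF integralE.
split; first by rewrite FX; exact: integrableB.
rewrite unlock -/(EFin \o (F \o X)) FX.
by rewrite integralB// -!(integral_mean mX Xq)// -gF [RHS]integralE.
Qed.

Lemma expected_loss_bayes_fin (A : Type) (L : Z -> A -> \bar R)
    (bayes : I -> A) (D : I -> I -> R) :
  loss_with_bayes_acts P L bayes ->
  (forall i j, (D i j)%:E =
     expected_loss P L i (bayes j) - expected_loss P L i (bayes i)) ->
  forall i j, expected_loss P L i (bayes j) \is a fin_num.
Proof.
move=> [_ Lbayes] DL i j; have [inf_fin infE] := Lbayes i.
move: (DL i j); rewrite -infE in inf_fin.
case: (expected_loss P L i (bayes i)) inf_fin => // r _.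
by case: (expected_loss P L i (bayes j)).
Qed.

(** The Bayes risk at [P i], which need not be affine in [i], cancels in
    [D i j - D i j0]. *)
Lemma coherent_affine (D : I -> I -> R) :
  coherent P D -> forall j j0, affine P (fun i => (D i j - D i j0)%R).
Proof.
move=> [A [L [bayes [LB DL]]]] j j0.
have Lfin := expected_loss_bayes_fin LB DL.
have iL i k : (P i).-integrable setT (L ^~ (bayes k)).
  apply: fin_num_integrable; last exact: Lfin.
  by case: LB => /(_ i (bayes k)) [].
apply: (@affine_expectation _ (L ^~ (bayes j) \- L ^~ (bayes j0))) => i.
  by apply: integrableB => //; exact: iL.
rewrite (integralB measurableT (iL i j) (iL i j0)) EFinB !DL.
rewrite -/(expected_loss P L i (bayes j)) -/(expected_loss P L i (bayes j0)).
rewrite -(fineK (Lfin i j)) -(fineK (Lfin i j0)) -(fineK (Lfin i i)).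
by rewrite -!EFinB opprB addrA subrK.
Qed.

Lemma proper_score_of_affine (D : I -> I -> R) :
  (forall F : I -> R, affine P F -> presentable P F) ->
  (forall i j, (0 <= D i j)%R) -> (forall i, D i i = 0%R) ->
  (forall j j0, affine P (fun i => (D i j - D i j0)%R)) ->
  forall j0, exists S : Z -> I -> \bar R,
    proper_scoring_rule P S /\
    (forall i j, discrepancy P S i j = (D i j)%:E) /\
    (forall i, uncertainty P S i = (- D i j0)%:E).
Proof.
move=> pres D_ge0 D_diag affD j0.
have [f fP] := choice (fun j => pres _ (affD j j0)).
pose S z j := (f j z)%:E.
have SE i j : expected_score P S i j = (D i j - D i j0)%:E.
  by have [_ <-] := fP j i; rewrite unlock.
have Sii i : expected_score P S i i = (- D i j0)%:E.
  by rewrite SE D_diag sub0r.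
exists S; split; last split.
- split; last split.
  + move=> i j; have [fi _] := fP j i; split; first exact: measurable_int fi.
    by left; exact: integral_funepos_lt_pinfty fi.
  + by move=> i; rewrite Sii.
  + by move=> i j; rewrite Sii SE lee_fin lerDr.
- by move=> i j; rewrite /discrepancy Sii SE -EFinB opprK subrK.
- exact: Sii.
Qed.

Lemma proper_scoring_rule_coherent (S : Z -> I -> \bar R) (D : I -> I -> R) :
  proper_scoring_rule P S -> (forall i j, discrepancy P S i j = (D i j)%:E) ->
  coherent P D.
Proof.
move=> [Sexp [Sfin Sproper]] SD.
exists I, S, id; split; last by move=> i j; rewrite -SD.
split=> // i.
have -> : ereal_inf (range (expected_loss P S i)) = expected_loss P S i i.
  apply/eqP; rewrite eq_le; apply/andP; split.
    by apply: ereal_inf_lbound; exists i.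
  by apply: le_ereal_inf_tmp => _ [j _ <-]; exact: Sproper.
by split=> //; exact: Sfin.
Qed.

(** Coherence does not refer to a base point [j0]; over an empty index type
    there is none to build a score from, and any loss will do. *)
Lemma affine_coherent (D : I -> I -> R) :
  (forall F : I -> R, affine P F -> presentable P F) ->
  (forall i j, (0 <= D i j)%R) -> (forall i, D i i = 0%R) ->
  (forall j j0, affine P (fun i => (D i j - D i j0)%R)) -> coherent P D.
Proof.
move=> pres D_ge0 D_diag affD.
have [[j0]|I0] := pselect (inhabited I).
  have [S [Sproper [SD _]]] := proper_score_of_affine pres D_ge0 D_diag affD j0.
  exact: proper_scoring_rule_coherent SD.
have noI (i : I) : False by apply: I0.
by exists unit, (fun _ _ => 0), (fun=> tt); split; [split|] => i; case: (noI i).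
Qed.

End family.

Unset Implicit Arguments.
Local Close Scope ereal_scope.
Local Close Scope classical_set_scope.

Theorem mainTheorem4 (R : realType) (d : measure_display)
    (Z : measurableType d) (I : Type) (P : I -> probability Z R)
    (P_distinct : distinct_distributions P)
    (P_convex : convex_family P)
    (P_presentable : forall F : I -> R, affine P F -> presentable P F)
    (D : I -> I -> R)
    (D_ge0 : forall i j : I, 0 <= D i j)
    (D_diag : forall i : I, D i i = 0) :
  (coherent P D <-> forall j j0 : I, affine P (fun i => D i j - D i j0)) /\
  (coherent P D -> forall j0 : I,
     exists S : Z -> I -> \bar R,
       proper_scoring_rule P S /\
       (forall i j : I, discrepancy P S i j = (D i j)%:E) /\
       (forall i : I, uncertainty P S i = (- D i j0)%:E)).
Proof.
split; first split.
- exact: coherent_affine.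
- exact: affine_coherent.
- move=> /coherent_affine affD.
  exact: proper_score_of_affine.
Qed.
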